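(* Let a static electrogravitational field with metric $ds^2=g_{ij}dx^idx^j-e^{\omega}dt^2$, electric potential $\phi$, matter tensor $M^\mu{}_\nu$ and proper charge density $\sigma$ satisfy the Einstein–Maxwell equations, and suppose the field is of Majumdar-type, i.e. $e^{\omega}=\left(\frac B2\pm\phi\right)^2$ with $B$ constant. Then $$M^k{}_k-M^4{}_4=\pm\sigma ,$$ where $k$ is summed over $1,2,3$.
   Context: Greek indices run over $1,\dots,4$, Latin indices over $1,2,3$. A static space-time has, in suitable coordinates $(x^i,t)$ with $x^4=t$, metric $ds^2=g_{ij}dx^idx^j-e^{\omega}dt^2$, with the spatial metric $g_{ij}$ and $\omega$ depending only on the $x^i$. The total energy-momentum tensor is $T_{\mu\nu}=M_{\mu\nu}+E_{\mu\nu}$ ($M$ the matter tensor, $E$ the electromagnetic energy tensor), and Einstein's equations are $R_{\mu\nu}-\frac12Rg_{\mu\nu}=-\kappa T_{\mu\nu}$, with $\kappa$ constant and the sign convention for the Ricci tensor in which $R_{44}=-\frac12e^{\omega}(\triangle\omega+\frac12|d\omega|^2)$. The electromagnetic tensor is $F_{\mu\nu}=\nabla_\mu\phi_\nu-\nabla_\nu\phi_\mu$ with $\phi_\mu=(0,0,0,\phi)$, $\phi=\phi(x^i)$ (pure electric field), and $\frac12\kappa E_{\mu\nu}=F_\mu{}^{\alpha}F_{\nu\alpha}-\frac14F_{\alpha\beta}F^{\alpha\beta}g_{\mu\nu}$. Maxwell's equations are $\nabla_\nu F^{\mu\nu}=J^\mu=\frac12\kappa\sigma V^\mu$, with $V^\mu$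 the 4-velocity and $\sigma$ the proper charge density of the charged matter. Norms, index raising and the Laplacian $\triangle$ of functions of $x^i$ are with respect to $g_{ij}$. Explicitly the equations include $$\triangle\phi=\tfrac12\omega^{,i}\phi_{,i}+\tfrac12\kappa\sigma e^{\frac12\omega},\qquad -\tfrac12e^{\omega}\left(\triangle\omega+\tfrac12|d\omega|^2\right)=-\tfrac12\kappa(M^k{}_k-M^4{}_4)e^{\omega}-|d\phi|^2 .$$ *)

(* Defs.v *)
From HB Require Import structures.
From mathcomp Require Import all_boot all_order all_algebra.
From mathcomp Require Import all_classical all_reals all_analysis.

Set Implicit Arguments.
Unset Strict Implicit.
Unset Printing Implicit Defensive.

Import Order.TTheory GRing.Theory Num.Theory.
Import numFieldNormedType.Exports.

Local Open Scope classical_set_scope.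
Local Open Scope ring_scope.

(* Tensor calculus in a coordinate domain of R^n: points are row vectors,
   covector and vector fields are row-valued, rank-two tensor fields are
   matrix-valued, and the position of the indices (upper or lower) is recorded
   in comments and names only. *)
Section TensorCalculus.
Variables (R : realType) (n : nat).
Implicit Types (G S : 'rV[R]_n -> 'M[R]_n) (A : 'rV[R]_n -> 'rV[R]_n).

Definition partial (i : 'I_n) (f : 'rV[R]_n -> R) (x : 'rV[R]_n) : R :=
  'D_(delta_mx ord0 i) f x.

Fixpoint Ck (k : nat) (U : set 'rV[R]_n) (f : 'rV[R]_n -> R) : Prop :=
  match k with
  | 0 => forall x, U x -> {for x, continuous f}
  | k'.+1 => (forall x, U x -> differentiable f x) /\
             (forall i, Ck k' U (partial i f))
  end.

Definition christoffel G (k i j : 'I_n) (x : 'rV[R]_n) : R :=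
  2^-1 * \sum_l invmx (G x) k l *
    (partial i (fun y => G y l j) x + partial j (fun y => G y l i) x
     - partial l (fun y => G y i j) x).

(* Sign convention: this is the opposite of the Ricci tensor which is positive
   on round spheres, so that a static metric g_ij dx^i dx^j - e^w dt^2 has
   R_44 = - e^w (Laplacian w + |dw|^2 / 2) / 2. *)
Definition ricci G (x : 'rV[R]_n) (i j : 'I_n) : R :=
  \sum_k (partial j (christoffel G k i k) x - partial k (christoffel G k i j) x)
  + \sum_k \sum_l (christoffel G k l j x * christoffel G l i k x
                   - christoffel G k l k x * christoffel G l i j x).

Definition scalar_curvature G (x : 'rV[R]_n) : R :=
  \sum_i \sum_j invmx (G x) i j * ricci G x i j.

(* S^i_j *)
Definition raise1 G S (x : 'rV[R]_n) (i j : 'I_n) : R :=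
  \sum_a invmx (G x) i a * S x a j.

(* S_i^j *)
Definition raise2 G S (x : 'rV[R]_n) (i j : 'I_n) : R :=
  \sum_a invmx (G x) j a * S x i a.

(* S^ij *)
Definition raise G S (x : 'rV[R]_n) (i j : 'I_n) : R :=
  \sum_a \sum_b invmx (G x) i a * invmx (G x) j b * S x a b.

(* nabla_i A_j, for a covector field A *)
Definition nabla_covector G A (i j : 'I_n) (x : 'rV[R]_n) : R :=
  partial i (fun y => A y ord0 j) x
  - \sum_k christoffel G k i j x * A x ord0 k.

(* nabla_k S^ij, for a field S with two upper indices *)
Definition nabla_upper2 G (S : 'rV[R]_n -> 'I_n -> 'I_n -> R) (k i j : 'I_n)
    (x : 'rV[R]_n) : R :=
  partial k (fun y => S y i j) x
  + \sum_l christoffel G i k l x * S x l j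
  + \sum_l christoffel G j k l x * S x i l.

(* F_ij = nabla_i A_j - nabla_j A_i *)
Definition field_tensor G A (x : 'rV[R]_n) : 'M[R]_n :=
  \matrix_(i, j) (nabla_covector G A i j x - nabla_covector G A j i x).

(* F_i^a F_ja - (1/4) F_ab F^ab g_ij *)
Definition em_stress G A (x : 'rV[R]_n) (i j : 'I_n) : R :=
  let F := field_tensor G A in
  \sum_a raise2 G F x i a * F x j a
  - 4^-1 * (\sum_a \sum_b F x a b * raise G F x a b) * G x i j.

(* J^i = nabla_j F^ij *)
Definition current G A (x : 'rV[R]_n) (i : 'I_n) : R :=
  \sum_j nabla_upper2 G (raise G (field_tensor G A)) j i j x.

Definition einstein_equations (kappa : R) G (T : 'rV[R]_n -> 'M[R]_n)
    (D : set 'rV[R]_n) : Prop :=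
  forall x, D x -> forall i j,
    ricci G x i j - 2^-1 * scalar_curvature G x * G x i j = - kappa * T x i j.

Definition maxwell_equations (kappa : R) G A (sigma : 'rV[R]_n -> R)
    (V : 'rV[R]_n -> 'rV[R]_n) (D : set 'rV[R]_n) : Prop :=
  forall x, D x -> forall i,
    current G A x i = 2^-1 * kappa * sigma x * V x ord0 i.

Definition riemannian_metric (U : set 'rV[R]_n) G : Prop :=
  [/\ forall i j, Ck 2 U (fun x => G x i j),
      forall x, U x -> (G x)^T = G x &
      forall x, U x -> forall v : 'rV[R]_n, v != 0 ->
        0 < (v *m G x *m v^T) ord0 ord0].

End TensorCalculus.

(* Events are (x^1, x^2, x^3, t) : 'rV_(3 + 1). *)
Section StaticSpacetime.
Variable R : realType.

Definition spatial_part (X : 'rV[R]_(3 + 1)) : 'rV[R]_3 := lsubmx X.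

Definition space_index (k : 'I_3) : 'I_(3 + 1) := lshift 1 k.
Definition time_index : 'I_(3 + 1) := rshift 3 ord0.

Definition static_region (U : set 'rV[R]_3) : set 'rV[R]_(3 + 1) :=
  spatial_part @^-1` U.

Definition static_metric (g : 'rV[R]_3 -> 'M[R]_3) (omega : 'rV[R]_3 -> R)
    (X : 'rV[R]_(3 + 1)) : 'M[R]_(3 + 1) :=
  block_mx (g (spatial_part X)) 0 0 (- expR (omega (spatial_part X)))%:M.

Definition electric_potential (phi : 'rV[R]_3 -> R) (X : 'rV[R]_(3 + 1)) :
    'rV[R]_(3 + 1) :=
  row_mx 0 (phi (spatial_part X))%:M.

(* Unit timelike and future-directed. *)
Definition four_velocity (G : 'rV[R]_(3 + 1) -> 'M[R]_(3 + 1))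
    (V : 'rV[R]_(3 + 1) -> 'rV[R]_(3 + 1)) (D : set 'rV[R]_(3 + 1)) : Prop :=
  forall X, D X -> (V X *m G X *m (V X)^T) ord0 ord0 = -1 /\
                   0 < V X ord0 time_index.

(* S^k_k - S^4_4, with k summed over the spatial indices *)
Definition trace_difference (G S : 'rV[R]_(3 + 1) -> 'M[R]_(3 + 1))
    (X : 'rV[R]_(3 + 1)) : R :=
  \sum_(k < 3) raise1 G S X (space_index k) (space_index k)
  - raise1 G S X time_index time_index.

End StaticSpacetime.

(* Main.v *)
(* Put N = B/2 + s phi, so that e^omega = N^2 and N is, up to sign, the lapse.
   For a static metric R_44 = - N (Laplacian N), and d N = s d phi turns this
   into - s N (Laplacian phi).  As the electromagnetic stress is trace-free in
   dimension four, the trace-reversed Einstein equation for R_44 reads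
     (kappa / 2) (M^k_k - M^4_4) = N^-2 (s N (Laplacian phi) - |d phi|^2),
   and since s^2 = 1 the right-hand side is s N J^4, because
     J^4 = N^-2 (Laplacian phi - s |d phi|^2 / N).
   The spatial components of the current vanish, so where sigma <> 0 the matter
   is at rest, V^4 = 1 / |N|, and J^4 = (kappa / 2) sigma / |N|.  The resulting
   sign s N / |N| is constant on a connected U since N never vanishes there. *)
Require Import Defs.
From mathcomp Require Import all_boot all_order all_algebra.
From mathcomp Require Import all_classical all_reals all_analysis.
From mathcomp Require Import ring lra.
Import Order.TTheory GRing.Theory Num.Theory.
Import numFieldNormedType.Exports.
Local Open Scope classical_set_scope.
Local Open Scope ring_scope.

Set Implicit Arguments.
Unset Strict Implicit.
Unset Printing Implicit Defensive.

(** * Directional derivatives, the inverse metric and the symmetry of the connection *)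

Section PartialDerivatives.
Context {R : realType} {n : nat}.
Implicit Types (f h : 'rV[R]_n -> R) (x : 'rV[R]_n) (i : 'I_n).

Lemma partial_near i f h x :
  {near x, f =1 h} -> partial i f x = partial i h x.
Proof. by move=> fh; apply: near_eq_derive. Qed.

Lemma partial_cst i (c : R) x : partial i (fun=> c) x = 0.
Proof. exact: derive_cst. Qed.

Lemma partialM i f h x :
  derivable f x (delta_mx ord0 i) -> derivable h x (delta_mx ord0 i) ->
  partial i (fun y => f y * h y) x = f x * partial i h x + h x * partial i f x.
Proof. by move=> df dh; exact: (deriveM df dh). Qed.

Lemma partialN i f x :
  derivable f x (delta_mx ord0 i) ->
  partial i (fun y => - f y) x = - partial i f x.
Proof. by move=> df; exact: (deriveN df). Qed.

Lemma partialV i f x : f x != 0 -> derivable f x (delta_mx ord0 i) ->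
  partial i (fun y => (f y)^-1) x = - (f x) ^- 2 * partial i f x.
Proof. by move=> fx0 df; rewrite /partial (deriveV fx0 df). Qed.

Lemma derivable_prod (I : Type) (r : seq I) (F : I -> 'rV[R]_n -> R) x (v : 'rV[R]_n) :
  (forall k, derivable (F k) x v) -> derivable (fun y => \prod_(i <- r) F i y) x v.
Proof.
move=> dF; elim: r => [|k r IHr].
  by under eq_fun do rewrite big_nil; exact: derivable_cst.
under eq_fun do rewrite big_cons.
exact: (derivableM (dF k) IHr).
Qed.

Lemma derivable_sum_seq (I : Type) (r : seq I) (F : I -> 'rV[R]_n -> R) x (v : 'rV[R]_n) :
  (forall k, derivable (F k) x v) -> derivable (fun y => \sum_(i <- r) F i y) x v.
Proof.
move=> dF; elim: r => [|k r IHr].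
  by under eq_fun do rewrite big_nil; exact: derivable_cst.
under eq_fun do rewrite big_cons.
exact: (derivableD (dF k) IHr).
Qed.

(** By the Leibniz expansion, the determinant is a finite sum of products of entries with constant
    signs. *)
Lemma derivable_det m (S : 'rV[R]_n -> 'M[R]_m) x (v : 'rV[R]_n) :
  (forall a b, derivable (fun y => S y a b) x v) ->
  derivable (fun y => \det (S y)) x v.
Proof.
move=> dS; apply: derivable_sum_seq => s.
apply: (@derivableM _ _ (cst _)); [exact: derivable_cst|exact: derivable_prod].
Qed.

(** Cramer's rule: where [S] is invertible, an entry of the inverse is a cofactor divided by the
    determinant, and both are polynomials in the entries. Invertibility is asked on a neighbourhood
    because a derivative depends on the germ. *)
Lemma derivable_invmx m (S : 'rV[R]_n -> 'M[R]_m) x (v : 'rV[R]_n) :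
  (forall a b, derivable (fun y => S y a b) x v) ->
  (\forall y \near x, S y \in unitmx) ->
  forall a b, derivable (fun y => invmx (S y) a b) x v.
Proof.
move=> dS uS a b.
apply: (@near_eq_derivable _ _ _
  (fun y => (\det (S y))^-1 * cofactor (S y) b a)).
  near=> y; have Sy : S y \in unitmx by near: y.
  by rewrite /invmx Sy !mxE.
apply: (@derivableM _ _ (fun y => (\det (S y))^-1)).
  apply: derivableV; last exact: derivable_det.
  by rewrite -unitfE -unitmxE; exact: nbhs_singleton uS.
apply: (@derivableM _ _ (cst _)); first exact: derivable_cst.
by apply: derivable_det => c d; under eq_fun do rewrite !mxE; exact: dS.
Unshelve. all: by end_near. Qed.

(** Exchanging [i] and [j] swaps the first two derivatives. The third is unchanged because the
    symmetry of [G] holds near [x], and so passes to derivatives. *)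
Lemma christoffel_sym (G : 'rV[R]_n -> 'M[R]_n) x :
  (\forall y \near x, (G y)^T = G y) ->
  forall k i j, christoffel G k i j x = christoffel G k j i x.
Proof.
move=> Gsym k i j; rewrite /christoffel; congr (_ * _); apply: eq_bigr => l _.
congr (_ * _); rewrite [partial l _ x](@partial_near l _ (fun y => G y j i)).
  by rewrite [X in X - _]addrC.
by near=> y; rewrite -[in LHS](near Gsym y)// mxE.
Unshelve. all: by end_near. Qed.

End PartialDerivatives.

(** A nonzero kernel vector would have zero length, against positive definiteness. *)
Lemma riemannian_unitmx {R : realType} {n} (U : set 'rV[R]_n)
    (g : 'rV[R]_n -> 'M[R]_n) x :
  riemannian_metric U g -> U x -> g x \in unitmx.
Proof.
move=> [_ _ pos] Ux; rewrite unitmxE unitfE; apply/det0P => -[v v0 vg].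
by have := pos x Ux v v0; rewrite vg mul0mx mxE ltxx.
Qed.

(** * Stationary functions and the 3+1 splitting *)

Section Stationary.
Context {R : realType} {U : set 'rV[R]_3}.
Hypothesis openU : open U.

(** Since [spatial_part] is linear, the two difference quotients are the same function of the
    increment. *)
Lemma derive_spatial_part (h : 'rV[R]_3 -> R) X v :
  'D_v (fun Y => h (spatial_part Y)) X
  = 'D_(spatial_part v) h (spatial_part X).
Proof.
rewrite /derive.
suff -> : (fun c => c^-1 *: ((((fun Y => h (spatial_part Y)) \o shift X) (c *: v))
    - h (spatial_part X))) =
  (fun c => c^-1 *: ((h \o shift (spatial_part X)) (c *: spatial_part v)
    - h (spatial_part X))) by [].
apply/funext => c /=; congr (_ *: (h _ - _)).
by apply/rowP => j; rewrite !mxE.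
Qed.

Lemma spatial_part_space (k : 'I_3) :
  spatial_part (delta_mx ord0 (space_index k)) = delta_mx ord0 k :> 'rV[R]_3.
Proof. by apply/matrixP => i j; rewrite !mxE eq_lshift. Qed.

Lemma spatial_part_time :
  spatial_part (delta_mx ord0 time_index) = 0 :> 'rV[R]_3.
Proof. by apply/matrixP => i j; rewrite !mxE eq_lrshift andbF. Qed.

Lemma near_static_region X :
  static_region U X -> \forall Y \near X, static_region U Y.
Proof.
move=> UX; apply: (@continuous_lsubmx R 1 3 1 X U); exact: open_nbhs_nbhs.
Qed.

(** Reduces spacetime derivatives to spatial ones. Agreement over the region is enough, since its
    openness turns this into agreement of germs. *)
Lemma partial_space (f : 'rV[R]_(3 + 1) -> R) (h : 'rV[R]_3 -> R) k X :
  static_region U X ->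
  (forall Y, static_region U Y -> f Y = h (spatial_part Y)) ->
  partial (space_index k) f X = partial k h (spatial_part X).
Proof.
move=> UX fh.
rewrite (@partial_near _ _ _ _ (fun Y => h (spatial_part Y))).
  by rewrite /partial derive_spatial_part spatial_part_space.
by near=> Y; apply: fh; near: Y; exact: near_static_region.
Unshelve. all: by end_near. Qed.

Lemma partial_time (f : 'rV[R]_(3 + 1) -> R) (h : 'rV[R]_3 -> R) X :
  static_region U X ->
  (forall Y, static_region U Y -> f Y = h (spatial_part Y)) ->
  partial time_index f X = 0.
Proof.
move=> UX fh.
rewrite (@partial_near _ _ _ _ (fun Y => h (spatial_part Y))).
  by rewrite /partial derive_spatial_part spatial_part_time derive0.
by near=> Y; apply: fh; near: Y; exact: near_static_region.
Unshelve. all: by end_near. Qed.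

End Stationary.

Lemma sum_spacetime (V : nmodType) (F : 'I_(3 + 1) -> V) :
  \sum_i F i = \sum_k F (space_index k) + F time_index.
Proof. by rewrite big_split_ord big_ord1. Qed.

(* Contravariant gradient h^{,k}. *)
Definition gradient {R : realType} {n} (g : 'rV[R]_n -> 'M[R]_n)
    (h : 'rV[R]_n -> R) (k : 'I_n) (x : 'rV[R]_n) : R :=
  \sum_l invmx (g x) k l * partial l h x.

(** The divergence of the gradient is written with the contracted connection rather than with the
    square root of the determinant: this is the shape in which it appears in the Ricci tensor and in
    the current. *)
Definition laplacian {R : realType} {n} (g : 'rV[R]_n -> 'M[R]_n)
    (h : 'rV[R]_n -> R) (x : 'rV[R]_n) : R :=
  \sum_k partial k (gradient g h k) x
  + \sum_k \sum_l christoffel g k k l x * gradient g h l x.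

Definition gradient_dot {R : realType} {n} (g : 'rV[R]_n -> 'M[R]_n)
    (h1 h2 : 'rV[R]_n -> R) (x : 'rV[R]_n) : R :=
  \sum_k partial k h1 x * gradient g h2 k x.

(* A weakening of [Ck 2] to directional derivatives: unlike [Ck], it is
   immediate for functions known only through their germs at points of U. *)
Definition twice_derivable {R : realType} {n} (U : set 'rV[R]_n)
    (h : 'rV[R]_n -> R) : Prop :=
  (forall x v, U x -> derivable h x v) /\
  (forall i x v, U x -> derivable (partial i h) x v).

Lemma Ck2_twice_derivable {R : realType} {n} (U : set 'rV[R]_n) h :
  Ck 2 U h -> twice_derivable U h.
Proof.
move=> [dh d2h]; split=> [x v Ux|i x v Ux]; apply: diff_derivable.
  exact: dh.
by case: (d2h i) => d1 _; exact: d1.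
Qed.

(** * Traces of the field equations *)

Section Traces.
Context {R : realType} {n : nat}.
Variables (G : 'rV[R]_n -> 'M[R]_n) (x : 'rV[R]_n).
Hypothesis Gsym : (G x)^T = G x.

Lemma invmx_metric_sym i j : invmx (G x) i j = invmx (G x) j i.
Proof. by rewrite -[in LHS]Gsym -trmx_inv mxE. Qed.

Lemma trace_raise1 S :
  \sum_i raise1 G S x i i = \sum_i \sum_j invmx (G x) i j * S x i j.
Proof.
rewrite exchange_big/=; apply: eq_bigr => i _; apply: eq_bigr => j _.
by rewrite [in LHS]invmx_metric_sym.
Qed.

Lemma trace_metric : G x \in unitmx ->
  \sum_i \sum_j invmx (G x) i j * G x i j = n%:R.
Proof.
move=> Gunit; rewrite -(mxtrace1 R n) -(mulVmx Gunit).
apply: eq_bigr => i _; rewrite mxE; apply: eq_bigr => j _.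
by congr (_ * _); rewrite -[in LHS]Gsym mxE.
Qed.

(** Contraction of the field equations with the inverse metric, the metric itself contributing the
    dimension [n]. *)
Lemma einstein_trace kappa T (D : set 'rV[R]_n) : G x \in unitmx ->
  einstein_equations kappa G T D -> D x ->
  scalar_curvature G x - 2^-1 * scalar_curvature G x * n%:R
  = - kappa * \sum_i \sum_j invmx (G x) i j * T x i j.
Proof.
move=> Gunit ein Dx; rewrite -(trace_metric Gunit).
have rE : scalar_curvature G x
    = \sum_i \sum_j invmx (G x) i j * ricci G x i j by [].
(* The scalar curvature becomes an atom [r], so that only its first occurrence is expanded as a
   double sum; the dimension is already a double sum, and the two sides can then be compared
   termwise. *)
move: (ein x Dx) rE; move: (scalar_curvature G x) => r {}ein rE.
rewrite {1}rE.
rewrite !mulr_sumr -sumrB; apply: eq_bigr => i _.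
rewrite !mulr_sumr -sumrB; apply: eq_bigr => j _.
by rewrite [RHS]mulrCA -ein; ring.
Qed.

Lemma raise_raise2 S i j :
  raise G S x i j = \sum_a invmx (G x) i a * raise2 G S x a j.
Proof.
apply: eq_bigr => a _; rewrite mulr_sumr; apply: eq_bigr => b _.
by rewrite mulrA.
Qed.

(** The quadratic term contracts to the full square of the field, and the metric term to [n / 4]
    times it. The resulting factor vanishes exactly for [n = 4]. *)
Lemma em_stress_trace A : G x \in unitmx ->
  \sum_i \sum_j invmx (G x) i j * em_stress G A x i j
  = (1 - 4^-1 * n%:R)
    * \sum_a \sum_b field_tensor G A x a b * raise G (field_tensor G A) x a b.
Proof.
move=> Gunit; rewrite /em_stress; set F := field_tensor G A.
set FF := \sum_a \sum_b F x a b * _.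
have FFE : \sum_i \sum_j invmx (G x) i j *
    (\sum_a raise2 G F x i a * F x j a) = FF.
  rewrite exchange_big /FF/=; apply: eq_bigr => j _.
  under [RHS]eq_bigr => a _ do rewrite raise_raise2 mulr_sumr.
  rewrite [RHS]exchange_big/=; apply: eq_bigr => i _.
  rewrite mulr_sumr; apply: eq_bigr => a _.
  by rewrite [in LHS]invmx_metric_sym; ring.
move: FF FFE => FF FFE.
(* On the right, the first [FF] and the dimension are turned back into double sums over [i] and [j],
   which leaves a termwise identity. *)
rewrite mulrBl mul1r -{2}FFE -(trace_metric Gunit) mulrAC.
rewrite [X in _ = _ - X]mulr_sumr -sumrB; apply: eq_bigr => i _.
rewrite [X in _ = _ - X]mulr_sumr -sumrB; apply: eq_bigr => j _.
by ring.
Qed.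

End Traces.

(** * Differential operators on affine functions of a potential *)

Section Affine.
Context {R : realType} {n : nat}.
Variables (U : set 'rV[R]_n) (openU : open U) (h : 'rV[R]_n -> R) (b s : R).
Hypothesis h_C2 : twice_derivable U h.

Lemma derivable_affine x (v : 'rV[R]_n) (f : 'rV[R]_n -> R) :
  derivable f x v -> derivable (fun y => b + s * f y) x v.
Proof.
move=> df; apply: (@derivableD _ _ _ (cst b) (fun y => s * f y)).
  exact: derivable_cst.
exact: (@derivableZ _ _ _ f s).
Qed.

Lemma partialZ (i : 'I_n) (f : 'rV[R]_n -> R) x :
  derivable f x (delta_mx ord0 i) ->
  partial i (fun y => s * f y) x = s * partial i f x.
Proof. by move=> df; exact: (@deriveZ _ _ _ f s _ _ df). Qed.

Lemma partial_affine i x : U x ->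
  partial i (fun y => b + s * h y) x = s * partial i h x.
Proof.
move=> Ux; case: h_C2 => dh _.
have dhx := dh x (delta_mx ord0 i) Ux.
rewrite -partialZ// -[RHS]add0r -(partial_cst i b x).
apply: (@deriveD _ _ _ (cst b) (fun y => s * h y)); first exact: derivable_cst.
exact: (@derivableZ _ _ _ h s).
Qed.

Lemma twice_derivable_affine : twice_derivable U (fun y => b + s * h y).
Proof.
case: (h_C2) => dh d2h; split=> [x v Ux|i x v Ux].
  exact/derivable_affine/dh.
apply: (@near_eq_derivable _ _ _ (fun y => s * partial i h y)).
  near=> y; rewrite partial_affine//; near: y; exact: open_nbhs_nbhs.
exact: (@derivableZ _ _ _ (partial i h) s _ _ (d2h i x v Ux)).
Unshelve. all: by end_near. Qed.

Lemma gradient_affine g k x : U x ->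
  gradient g (fun y => b + s * h y) k x = s * gradient g h k x.
Proof.
move=> Ux; rewrite /gradient mulr_sumr; apply: eq_bigr => l _.
by rewrite partial_affine// mulrCA.
Qed.

Lemma laplacian_affine g x : U x ->
  (forall k, derivable (gradient g h k) x (delta_mx ord0 k)) ->
  laplacian g (fun y => b + s * h y) x = s * laplacian g h x.
Proof.
move=> Ux dgrad; rewrite /laplacian mulrDr !mulr_sumr; congr (_ + _).
  apply: eq_bigr => k _; rewrite -partialZ//; apply: partial_near.
  near=> y; rewrite gradient_affine//; near: y; exact: open_nbhs_nbhs.
apply: eq_bigr => k _; rewrite mulr_sumr; apply: eq_bigr => l _.
by rewrite gradient_affine// mulrCA.
Unshelve. all: by end_near. Qed.

Lemma gradient_dot_affine g f x : U x ->
  gradient_dot g (fun y => b + s * h y) f x = s * gradient_dot g h f x.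
Proof.
move=> Ux; rewrite /gradient_dot mulr_sumr; apply: eq_bigr => k _.
by rewrite partial_affine// mulrA.
Qed.

End Affine.

(** The image of a connected set is an interval, so values of both signs would force the value zero.
    It makes the sign of the lapse global. *)
Lemma connected_sgr_eq {R : realType} (T : topologicalType) (U : set T)
    (f : T -> R) :
  connected U -> (forall x, U x -> {for x, continuous f}) ->
  (forall x, U x -> f x != 0) ->
  forall x y, U x -> U y -> Num.sg (f x) = Num.sg (f y).
Proof.
move=> cU cf f0.
have itv : is_interval (f @` U).
  apply/connected_intervalP/connected_continuous_connected => //.
  by apply: continuous_in_subspaceT => x /set_mem; exact: cf.
have sgn x y : U x -> U y -> f x < 0 -> ~ 0 < f y.
  move=> Ux Uy fx0 fy0.
  have [z Uz fz] : (f @` U) 0.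
    by apply: (itv (f x) (f y)); [exists x|exists y|rewrite !ltW].
  by have := f0 z Uz; rewrite fz eqxx.
move=> x y Ux Uy; have := f0 x Ux; have := f0 y Uy.
case: (ltgtP (f y)) => // fy _; case: (ltgtP (f x)) => // fx _.
- by rewrite !ltr0_sg.
- by case: (sgn y x).
- by case: (sgn x y).
- by rewrite !gtr0_sg.
Qed.

(** * The static metric in terms of the lapse *)

Section StaticMetric.
Context {R : realType}.
Variables (U : set 'rV[R]_3) (g : 'rV[R]_3 -> 'M[R]_3).
Variables (omega N : 'rV[R]_3 -> R).
Hypothesis openU : open U.
Hypothesis g_metric : riemannian_metric U g.
Hypothesis N_C2 : twice_derivable U N.
Hypothesis lapse : forall x, U x -> expR (omega x) = N x ^+ 2.

Let G := static_metric g omega.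
Let D := static_region U.

Lemma lapse_neq0 x : U x -> N x != 0.
Proof. by move=> Ux; rewrite -sqrf_eq0 -lapse// gt_eqF// expR_gt0. Qed.

Lemma static_metricE X : D X ->
  G X = block_mx (g (spatial_part X)) 0 0 (- N (spatial_part X) ^+ 2)%:M.
Proof. by move=> DX; rewrite /G /static_metric lapse. Qed.

Lemma static_metric_ss X i j :
  G X (space_index i) (space_index j) = g (spatial_part X) i j.
Proof. exact: block_mxEul. Qed.

Lemma static_metric_st X i : G X (space_index i) time_index = 0.
Proof. by rewrite [LHS]block_mxEur mxE. Qed.

Lemma static_metric_ts X i : G X time_index (space_index i) = 0.
Proof. by rewrite [LHS]block_mxEdl mxE. Qed.

Lemma static_metric_tt X : D X ->
  G X time_index time_index = - N (spatial_part X) ^+ 2.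
Proof. by move=> DX; rewrite static_metricE// [LHS]block_mxEdr mxE. Qed.

Lemma static_unitmx X : D X -> G X \in unitmx.
Proof.
move=> DX; rewrite static_metricE// block_diag_mx_unit.
rewrite (riemannian_unitmx g_metric)//= unitmxE det_scalar1 unitfE.
by rewrite oppr_eq0 sqrf_eq0 lapse_neq0.
Qed.

Lemma invmx_static_metric X : D X ->
  invmx (G X) =
  block_mx (invmx (g (spatial_part X))) 0 0 (- N (spatial_part X) ^- 2)%:M.
Proof.
move=> DX; rewrite static_metricE// invmx_block_diag.
  by rewrite invmx_scalar invrN.
by rewrite -static_metricE// static_unitmx.
Qed.

Lemma invmx_static_ss X i j : D X ->
  invmx (G X) (space_index i) (space_index j) = invmx (g (spatial_part X)) i j.
Proof. by move=> DX; rewrite invmx_static_metric// block_mxEul. Qed.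

Lemma invmx_static_st X i : D X ->
  invmx (G X) (space_index i) time_index = 0.
Proof. by move=> DX; rewrite invmx_static_metric// block_mxEur mxE. Qed.

Lemma invmx_static_ts X i : D X ->
  invmx (G X) time_index (space_index i) = 0.
Proof. by move=> DX; rewrite invmx_static_metric// block_mxEdl mxE. Qed.

Lemma invmx_static_tt X : D X ->
  invmx (G X) time_index time_index = - N (spatial_part X) ^- 2.
Proof. by move=> DX; rewrite invmx_static_metric// block_mxEdr mxE. Qed.

Lemma static_metric_sym X : D X -> (G X)^T = G X.
Proof.
move=> DX; rewrite static_metricE// tr_block_mx !trmx0 tr_scalar_mx.
by case: g_metric => _ -> .
Qed.

Lemma derivable_lapse x v : U x -> derivable N x v.
Proof. by case: N_C2 => dN _; exact: dN. Qed.

Lemma derivable_gradient h k x v : twice_derivable U h -> U x ->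
  derivable (gradient g h k) x v.
Proof.
move=> [_ d2h] Ux; apply: derivable_sum_seq => l; apply: derivableM.
  apply: derivable_invmx; first by
    move=> a b; case: g_metric => /(_ a b)[dg _] _ _; exact/diff_derivable/dg.
  near=> y; apply: (riemannian_unitmx g_metric); near: y.
  exact: open_nbhs_nbhs.
exact: d2h.
Unshelve. all: by end_near. Qed.

Lemma partial_static_time X i j : D X ->
  partial time_index (fun Y => G Y i j) X = 0.
Proof.
move=> DX.
(* The stationary representative is the restriction of the metric to the slice of time zero. *)
apply: (partial_time openU DX (h := fun y => G (row_mx y 0) i j)) => Y _.
by rewrite /G /static_metric /spatial_part row_mxKl.
Qed.

Lemma partial_static_ss X k i j : D X ->
  partial (space_index k) (fun Y => G Y (space_index i) (space_index j)) X
  = partial k (fun y => g y i j) (spatial_part X).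
Proof.
move=> DX; apply: (partial_space openU) => // Y _.
exact: static_metric_ss.
Qed.

Lemma partial_static_st X k i :
  partial (space_index k) (fun Y => G Y (space_index i) time_index) X = 0.
Proof.
under [X in partial _ X]eq_fun do rewrite static_metric_st.
exact: partial_cst.
Qed.

Lemma partial_static_ts X k i :
  partial (space_index k) (fun Y => G Y time_index (space_index i)) X = 0.
Proof.
under [X in partial _ X]eq_fun do rewrite static_metric_ts.
exact: partial_cst.
Qed.

Lemma partial_static_tt X k : D X ->
  partial (space_index k) (fun Y => G Y time_index time_index) X
  = - (2 * N (spatial_part X) * partial k N (spatial_part X)).
Proof.
move=> DX.
rewrite (@partial_space _ _ openU _ (fun y => - (N y * N y)) k X DX); last first.
  by move=> Y DY; rewrite static_metric_tt// expr2.
have dN := @derivable_lapse (spatial_part X) (delta_mx ord0 k) DX.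
rewrite partialN; last exact: derivableM.
by rewrite partialM//; ring.
Qed.

(** The inverse metric is block diagonal, so raising to a time index keeps only the time entry,
    which is minus the inverse square of the lapse. *)
Lemma christoffel_time X i j : D X ->
  christoffel G time_index i j X =
  - (2 * N (spatial_part X) ^+ 2)^-1 *
    (partial i (fun Y => G Y time_index j) X
     + partial j (fun Y => G Y time_index i) X
     - partial time_index (fun Y => G Y i j) X).
Proof.
move=> DX; rewrite /christoffel sum_spacetime big1 ?add0r.
  by rewrite invmx_static_tt// mulrA mulrN -invfM.
by move=> l _; rewrite invmx_static_ts// mul0r.
Qed.

Lemma christoffel_space X k i j : D X ->
  christoffel G (space_index k) i j X =
  2^-1 * \sum_l invmx (g (spatial_part X)) k l *
    (partial i (fun Y => G Y (space_index l) j) X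
     + partial j (fun Y => G Y (space_index l) i) X
     - partial (space_index l) (fun Y => G Y i j) X).
Proof.
move=> DX; rewrite /christoffel sum_spacetime invmx_static_st// mul0r addr0.
by congr (_ * _); apply: eq_bigr => l _; rewrite invmx_static_ss.
Qed.

Lemma christoffel_ttt X : D X ->
  christoffel G time_index time_index time_index X = 0.
Proof.
by move=> DX; rewrite christoffel_time// !partial_static_time// subr0 addr0 mulr0.
Qed.

Lemma christoffel_tss X k l : D X ->
  christoffel G time_index (space_index k) (space_index l) X = 0.
Proof.
move=> DX; rewrite christoffel_time// !partial_static_ts//.
by rewrite partial_static_time// subr0 addr0 mulr0.
Qed.

Lemma christoffel_tst X k : D X ->
  christoffel G time_index (space_index k) time_index X
  = partial k N (spatial_part X) / N (spatial_part X).
Proof.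
move=> DX; rewrite christoffel_time// !partial_static_time// partial_static_tt//.
by have N0 := @lapse_neq0 (spatial_part X) DX; field.
Qed.

Lemma christoffel_tts X k : D X ->
  christoffel G time_index time_index (space_index k) X
  = partial k N (spatial_part X) / N (spatial_part X).
Proof.
move=> DX; rewrite christoffel_time// !partial_static_time// partial_static_tt//.
by have N0 := @lapse_neq0 (spatial_part X) DX; field.
Qed.

Lemma christoffel_stt X k : D X ->
  christoffel G (space_index k) time_index time_index X
  = N (spatial_part X) * gradient g N k (spatial_part X).
Proof.
move=> DX; rewrite christoffel_space// /gradient !mulr_sumr.
apply: eq_bigr => l _; rewrite !partial_static_time// partial_static_tt//.
by field.
Qed.

Lemma christoffel_sst X k l : D X ->
  christoffel G (space_index k) (space_index l) time_index X = 0.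
Proof.
move=> DX; rewrite christoffel_space// big1 ?mulr0// => m _.
by rewrite !partial_static_time// !partial_static_st// subr0 addr0 mulr0.
Qed.

Lemma christoffel_sts X k l : D X ->
  christoffel G (space_index k) time_index (space_index l) X = 0.
Proof.
move=> DX; rewrite christoffel_space// big1 ?mulr0// => m _.
rewrite !partial_static_time// partial_static_st// partial_static_ts//.
by rewrite subr0 addr0 mulr0.
Qed.

Lemma christoffel_sss X k l m : D X ->
  christoffel G (space_index k) (space_index l) (space_index m) X
  = christoffel g k l m (spatial_part X).
Proof.
move=> DX; rewrite christoffel_space//; congr (_ * _); apply: eq_bigr => a _.
by rewrite !partial_static_ss.
Qed.

Lemma spatial_christoffel_sym x k i j : U x ->
  christoffel g k i j x = christoffel g k j i x.
Proof.
move=> Ux; apply: christoffel_sym; near=> y.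
case: g_metric => _ sym _; apply: sym; near: y; exact: open_nbhs_nbhs.
Unshelve. all: by end_near. Qed.

(** With $\Gamma^k_{tt} = N N^{,k}$ and $\Gamma^t_{kt} = N_{,k}/N$, the product rule applied to
    $-\partial_k \Gamma^k_{tt}$ yields $-N_{,k} N^{,k}$, which the product $\Gamma^k_{tt}
    \Gamma^t_{tk}$ cancels. The rest is [- N] times the divergence of the gradient of [N]. *)
Lemma ricci_static_tt X : D X ->
  ricci G X time_index time_index
  = - N (spatial_part X) * laplacian g N (spatial_part X).
Proof.
move=> DX; set x := spatial_part X.
have dN k : derivable N x (delta_mx ord0 k) by exact: derivable_lapse.
have dgrad k : derivable (gradient g N k) x (delta_mx ord0 k).
  exact: derivable_gradient.
have Etime (k : 'I_(3 + 1)) :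
    partial time_index (christoffel G k time_index k) X = 0.
  have [l ->|l ->] := split_ordP k.
    apply: (partial_time openU DX (h := fun=> 0)) => Y DY.
    exact: christoffel_sts.
  rewrite (ord1 l); apply: (partial_time openU DX (h := fun=> 0)) => Y DY.
  exact: christoffel_ttt.
have Espace k :
    partial (space_index k)
      (christoffel G (space_index k) time_index time_index) X
    = N x * partial k (gradient g N k) x + gradient g N k x * partial k N x.
  rewrite -partialM//; apply: (partial_space openU) => // Y DY.
  exact: christoffel_stt.
have Ett : partial time_index
    (christoffel G time_index time_index time_index) X = 0.
  exact: Etime.
rewrite /ricci !sum_spacetime.
under eq_bigr => k _ do rewrite Etime Espace sub0r.
have inner k : \sum_l
      (christoffel G (space_index k) l time_index X
         * christoffel G l time_index (space_index k) X
       - christoffel G (space_index k) l (space_index k) X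
         * christoffel G l time_index time_index X)
    = N x * gradient g N k x * (partial k N x / N x)
      - \sum_l christoffel g k k l x * (N x * gradient g N l x).
  rewrite sum_spacetime christoffel_stt// christoffel_tts// christoffel_ttt//.
  rewrite mulr0 subr0 -sumrN addrC; congr (_ + _).
  apply: eq_bigr => l _; rewrite christoffel_sst// christoffel_sss//.
  by rewrite christoffel_stt// mul0r sub0r spatial_christoffel_sym.
rewrite Ett subrr addr0 (eq_bigr _ (fun k _ => inner k)).
(* When the summation index [k] of the quadratic part is time, its two products coincide and
   cancel. *)
rewrite [X in _ + (_ + (X + _))]big1; last by move=> k _; rewrite subrr.
rewrite subrr !addr0 -big_split/= /laplacian mulrDr.
rewrite [X in _ = X + _]mulr_sumr [X in _ = _ + X]mulr_sumr -big_split/=.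
apply: eq_bigr => k _; rewrite [X in _ = _ + X]mulr_sumr addrA -sumrN.
congr (_ + _).
  by have N0 := @lapse_neq0 x DX; field.
by apply: eq_bigr => l _; ring.
Unshelve. all: by []. Qed.

(** * Field tensor, stress and current of a static electric potential *)

Section ElectricField.
Variable phi : 'rV[R]_3 -> R.
Hypothesis phi_C2 : twice_derivable U phi.

Let A := electric_potential phi.
Let F := field_tensor G A.

Lemma electric_potential_space X k : A X ord0 (space_index k) = 0.
Proof. by rewrite /A /electric_potential row_mxEl mxE. Qed.

Lemma electric_potential_time X : A X ord0 time_index = phi (spatial_part X).
Proof. by rewrite /A /electric_potential row_mxEr mxE. Qed.

Lemma nabla_electric_potential X i j : nabla_covector G A i j X =
  partial i (fun Y => A Y ord0 j) X
  - christoffel G time_index i j X * phi (spatial_part X).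
Proof.
rewrite /nabla_covector sum_spacetime electric_potential_time big1 ?add0r//.
by move=> k _; rewrite electric_potential_space mulr0.
Qed.

Lemma field_tensor_tt X : F X time_index time_index = 0.
Proof. by rewrite mxE subrr. Qed.

Lemma field_tensor_ss X k l : D X ->
  F X (space_index k) (space_index l) = 0.
Proof.
move=> DX; rewrite mxE !nabla_electric_potential !christoffel_tss//.
have dA a b : partial (space_index a) (fun Y => A Y ord0 (space_index b)) X = 0.
  by under [X in partial _ X]eq_fun do rewrite electric_potential_space;
     exact: partial_cst.
by rewrite !dA subrr.
Qed.

Lemma field_tensor_st X k : D X ->
  F X (space_index k) time_index = partial k phi (spatial_part X).
Proof.
move=> DX; rewrite mxE !nabla_electric_potential.
rewrite christoffel_tst// christoffel_tts//.
rewrite (@partial_space _ _ openU _ phi k X DX); last first.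
  by move=> Y _; exact: electric_potential_time.
rewrite (partial_time openU DX (h := fun=> 0)); last first.
  by move=> Y _; exact: electric_potential_space.
by rewrite sub0r opprK subrK.
Qed.

Lemma field_tensor_ts X k : D X ->
  F X time_index (space_index k) = - partial k phi (spatial_part X).
Proof.
move=> DX; rewrite -(field_tensor_st k DX) mxE [in RHS]mxE.
exact: (esym (opprB _ _)).
Qed.

Lemma raise_static_tt X : D X -> raise G F X time_index time_index = 0.
Proof.
move=> DX; rewrite /raise sum_spacetime big1 ?add0r => [|k _].
  rewrite sum_spacetime field_tensor_tt mulr0 addr0 big1// => l _.
  by rewrite invmx_static_ts// mulr0 mul0r.
by rewrite big1// => l _; rewrite invmx_static_ts// !mul0r.
Qed.

Lemma raise_static_ss X k l : D X ->
  raise G F X (space_index k) (space_index l) = 0.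
Proof.
move=> DX; rewrite /raise sum_spacetime big1 ?add0r => [|a _].
  by rewrite big1// => b _; rewrite invmx_static_st// !mul0r.
rewrite sum_spacetime invmx_static_st// mulr0 mul0r addr0 big1// => b _.
by rewrite field_tensor_ss// mulr0.
Qed.

Lemma raise_static_ts X k : D X ->
  raise G F X time_index (space_index k)
  = N (spatial_part X) ^- 2 * gradient g phi k (spatial_part X).
Proof.
move=> DX; rewrite /raise sum_spacetime big1 ?add0r => [|a _].
  rewrite sum_spacetime field_tensor_tt mulr0 addr0 /gradient mulr_sumr.
  apply: eq_bigr => l _; rewrite invmx_static_tt// invmx_static_ss//.
  by rewrite field_tensor_ts// -mulrA mulrN mulrNN.
by rewrite big1// => l _; rewrite invmx_static_ts// !mul0r.
Qed.

Lemma raise_static_st X k : D X ->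
  raise G F X (space_index k) time_index
  = - (N (spatial_part X) ^- 2 * gradient g phi k (spatial_part X)).
Proof.
move=> DX; rewrite /raise sum_spacetime [X in _ + X]big1 ?addr0 => [|a _].
  rewrite /gradient mulr_sumr -sumrN; apply: eq_bigr => l _.
  rewrite sum_spacetime big1 ?add0r => [|a _].
    rewrite invmx_static_tt// invmx_static_ss// field_tensor_st//.
    by rewrite mulrN mulNr -mulrA mulrCA mulrA.
  by rewrite invmx_static_ts// mulr0 mul0r.
by rewrite invmx_static_st// !mul0r.
Qed.

(** Here $F_t{}^a F_{ta} = |d\phi|^2$ and $F_{ab} F^{ab} = -2 N^{-2} |d\phi|^2$. Multiplied by
    $g_{tt} = -N^2$, the second term removes half of the first. *)
Lemma em_stress_static_tt X : D X ->
  em_stress G A X time_index time_index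
  = 2^-1 * gradient_dot g phi phi (spatial_part X).
Proof.
move=> DX; rewrite /em_stress -/F static_metric_tt//.
set x := spatial_part X.
have rF k : raise2 G F X time_index (space_index k) = - gradient g phi k x.
  rewrite /raise2 sum_spacetime invmx_static_st// mul0r addr0 -sumrN.
  apply: eq_bigr => l _.
  by rewrite invmx_static_ss// field_tensor_ts// mulrN.
have -> : \sum_a raise2 G F X time_index a * F X time_index a
    = gradient_dot g phi phi x.
  rewrite sum_spacetime field_tensor_tt mulr0 addr0; apply: eq_bigr => k _.
  by rewrite rF field_tensor_ts// mulrNN mulrC.
have -> : \sum_a \sum_b F X a b * raise G F X a b
    = - (2 * N x ^- 2 * gradient_dot g phi phi x).
  rewrite sum_spacetime [X in _ + X]sum_spacetime field_tensor_tt mul0r addr0.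
  rewrite /gradient_dot mulr_sumr -sumrN -big_split/=; apply: eq_bigr => k _.
  rewrite sum_spacetime big1 ?add0r => [|l _]; last first.
    by rewrite field_tensor_ss// mul0r.
  rewrite field_tensor_st// field_tensor_ts// raise_static_st//.
  by rewrite raise_static_ts// -/x; ring.
by have N0 := @lapse_neq0 x DX; field.
Qed.

(** Only the mixed components of the field survive. Their time derivatives vanish, and each
    connection coefficient multiplying them here has a spatial upper index and exactly one lower
    time index, or only time indices, hence is zero. *)
Lemma current_static_space X i : D X -> current G A X (space_index i) = 0.
Proof.
move=> DX; rewrite /current /nabla_upper2 -/F sum_spacetime.
rewrite big1 ?add0r => [|k _].
  rewrite (partial_time openU DX (h := fun y =>
    - (N y ^- 2 * gradient g phi i y))); last first.
    by move=> Y DY; exact: raise_static_st.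
  rewrite add0r !sum_spacetime raise_static_tt// christoffel_ttt//.
  rewrite mulr0 mul0r !addr0 !big1 ?addr0// => l _.
    by rewrite raise_static_ss// mulr0.
  by rewrite christoffel_sts// mul0r.
rewrite (@partial_space _ _ openU _ (fun=> 0) k X DX); last first.
  by move=> Y DY; exact: raise_static_ss.
rewrite partial_cst add0r !sum_spacetime !christoffel_sst// !mul0r !addr0.
by rewrite !big1 ?addr0// => l _; rewrite raise_static_ss// mulr0.
Qed.

Lemma partial_lapse_inv2M h k x : U x -> derivable h x (delta_mx ord0 k) ->
  partial k (fun y => N y ^- 2 * h y) x
  = N x ^- 2 * (partial k h x - 2 * (partial k N x / N x * h x)).
Proof.
move=> Ux dh; have N0 := lapse_neq0 Ux.
have dN := @derivable_lapse x (delta_mx ord0 k) Ux.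
have dN2 : derivable (fun y => N y * N y) x (delta_mx ord0 k).
  exact: derivableM.
have N20 : N x * N x != 0 by rewrite mulf_neq0.
have dV : derivable (fun y => (N y * N y)^-1) x (delta_mx ord0 k).
  exact: (@derivableV _ _ (fun y => N y * N y) _ _ N20 dN2).
(* [N y ^- 2] is convertible to [(N y * N y)^-1], to which the rules for products and inverses
   apply. *)
have -> : partial k (fun y => N y ^- 2 * h y) x = (N x * N x)^-1 * partial k h x
    + h x * partial k (fun y => (N y * N y)^-1) x.
  exact: (partialM dV dh).
have -> : partial k (fun y => (N y * N y)^-1) x
    = - (N x * N x) ^- 2 * partial k (fun y => N y * N y) x.
  exact: (@partialV _ _ k (fun y => N y * N y) x N20 dN2).
rewrite (partialM dN dN).
by field.
Qed.

(** Differentiating $N^{-2} \phi^{,k}$ gives the term $N_{,k} \phi^{,k}/N$ with coefficient -2, and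
    $\Gamma^t_{kt} F^{tk}$ gives it back once, so the net coefficient is -1. The remaining
    connection terms complete the Laplacian. *)
Lemma current_static_time X : D X ->
  current G A X time_index =
  N (spatial_part X) ^- 2 *
    (laplacian g phi (spatial_part X)
     - gradient_dot g N phi (spatial_part X) / N (spatial_part X)).
Proof.
move=> DX; set x := spatial_part X.
rewrite /current /nabla_upper2 -/F sum_spacetime.
have -> : partial time_index
    (fun Y => raise G F Y time_index time_index) X = 0.
  by apply: (partial_time openU DX (h := fun=> 0)) => Y DY; exact: raise_static_tt.
(* For differentiation along time, the two connection terms cancel by antisymmetry of the raised
   field. *)
have -> : \sum_l christoffel G time_index time_index l X
      * raise G F X l time_index
    = - \sum_l christoffel G time_index time_index l X
      * raise G F X time_index l.
  rewrite !sum_spacetime raise_static_tt// mulr0 !addr0 -sumrN.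
  apply: eq_bigr => l _.
  by rewrite raise_static_st// raise_static_ts// mulrN.
rewrite add0r addNr addr0.
have Ek k : partial (space_index k)
      (fun Y => raise G F Y time_index (space_index k)) X
    = N x ^- 2 * (partial k (gradient g phi k) x
                  - 2 * (partial k N x / N x * gradient g phi k x)).
  rewrite -partial_lapse_inv2M//; last exact: derivable_gradient.
  by apply: (partial_space openU) => // Y DY; exact: raise_static_ts.
rewrite /laplacian /gradient_dot mulr_suml -sumrN -!big_split/=.
rewrite mulr_sumr; apply: eq_bigr => k _; rewrite Ek.
have -> : \sum_l christoffel G time_index (space_index k) l X
      * raise G F X l (space_index k)
    = partial k N x / N x * (N x ^- 2 * gradient g phi k x).
  rewrite sum_spacetime big1 ?add0r => [|l _].
    by rewrite christoffel_tst// raise_static_ts.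
  by rewrite raise_static_ss// mulr0.
have -> : \sum_l christoffel G (space_index k) (space_index k) l X
      * raise G F X time_index l
    = N x ^- 2 * \sum_l christoffel g k k l x * gradient g phi l x.
  rewrite sum_spacetime raise_static_tt// mulr0 addr0 mulr_sumr.
  apply: eq_bigr => l _; rewrite christoffel_sss// raise_static_ts//.
  by rewrite mulrCA.
by ring.
Qed.

End ElectricField.
(** The difference is the full trace minus twice $S^t{}_t$, and $S^t{}_t = -N^{-2} S_{tt}$. Both
    pieces are accessible from the Einstein equations. *)
Lemma trace_difference_static S X : D X ->
  trace_difference G S X
  = \sum_i \sum_j invmx (G X) i j * S X i j
    + 2 * N (spatial_part X) ^- 2 * S X time_index time_index.
Proof.
move=> DX; rewrite -(trace_raise1 (static_metric_sym DX)) sum_spacetime.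
rewrite /trace_difference.
have -> : raise1 G S X time_index time_index
    = - N (spatial_part X) ^- 2 * S X time_index time_index.
  rewrite /raise1 sum_spacetime invmx_static_tt// big1 ?add0r// => k _.
  by rewrite invmx_static_ts// mul0r.
by ring.
Qed.

Lemma static_rest_velocity (V : 'rV[R]_(3 + 1) -> 'rV[R]_(3 + 1)) X : D X ->
  (forall k, V X ord0 (space_index k) = 0) ->
  (V X *m G X *m (V X)^T) ord0 ord0
  = - (N (spatial_part X) * V X ord0 time_index) ^+ 2.
Proof.
move=> DX V0; rewrite mxE sum_spacetime big1 ?add0r => [|k _]; last first.
  by rewrite [X in _ * X]mxE V0 mulr0.
rewrite [X in X * _]mxE [X in _ * X]mxE sum_spacetime big1 ?add0r => [|k _].
  by rewrite static_metric_tt//; ring.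
by rewrite V0 mul0r.
Qed.

End StaticMetric.
(** * Majumdar-type fields *)

Section Majumdar.
Context {R : realType}.
Variables (U : set 'rV[R]_3) (g : 'rV[R]_3 -> 'M[R]_3).
Variables (omega phi : 'rV[R]_3 -> R) (b s : R).
Hypothesis openU : open U.
Hypothesis g_metric : riemannian_metric U g.
Hypothesis phi_C2 : twice_derivable U phi.
Hypothesis s_sq : s ^+ 2 = 1.
Hypothesis majumdar : forall x, U x -> expR (omega x) = (b + s * phi x) ^+ 2.

Let N x := b + s * phi x.
Let G := static_metric g omega.
Let A := electric_potential phi.
Let D := static_region U.

Lemma majumdar_trace kappa (M E : 'rV[R]_(3 + 1) -> 'M[R]_(3 + 1)) X :
  (forall i j, 2^-1 * kappa * E X i j = em_stress G A X i j) ->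
  einstein_equations kappa G (fun X => M X + E X) D -> D X ->
  2^-1 * kappa * trace_difference G M X
  = s * N (spatial_part X) * current G A X time_index.
Proof.
move=> E_def ein DX; set x := spatial_part X.
have N_C2 : twice_derivable U N by exact: twice_derivable_affine.
have N0 : N x != 0 by exact: (lapse_neq0 majumdar DX).
have Gu : G X \in unitmx by exact: (static_unitmx g_metric majumdar DX).
have Gs : (G X)^T = G X by exact: (static_metric_sym g_metric majumdar DX).
have lapN : laplacian g N x = s * laplacian g phi x.
  apply: (laplacian_affine openU b s phi_C2 DX) => k.
  exact: (derivable_gradient openU g_metric).
have dotN : gradient_dot g N phi x = s * gradient_dot g phi phi x.
  exact: (gradient_dot_affine b s phi_C2).
have E_trace :
    2^-1 * kappa * \sum_i \sum_j invmx (G X) i j * E X i j = 0.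
  transitivity (\sum_i \sum_j invmx (G X) i j * em_stress G A X i j).
    rewrite mulr_sumr; apply: eq_bigr => i _.
    rewrite mulr_sumr; apply: eq_bigr => j _.
    by rewrite mulrCA E_def.
  (* Writing the dimension as 4 makes the factor [1 - 4^-1 * 4] visible. *)
  rewrite em_stress_trace// -[(3 + 1)%N]/4%N mulVf ?pnatr_eq0//.
  by rewrite subrr mul0r.
have E_tt : 2^-1 * kappa * E X time_index time_index
    = 2^-1 * gradient_dot g phi phi x.
  by rewrite E_def (em_stress_static_tt openU g_metric N_C2 majumdar).
have R_trace := einstein_trace Gs Gu ein DX.
have R_tt := ein X DX time_index time_index.
rewrite (ricci_static_tt openU g_metric N_C2 majumdar DX) in R_tt.
rewrite (static_metric_tt g majumdar DX) mxE -/x -/(N x) lapN in R_tt.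
have TE : \sum_i \sum_j invmx (G X) i j * (M X + E X) i j
    = \sum_i \sum_j invmx (G X) i j * M X i j
      + \sum_i \sum_j invmx (G X) i j * E X i j.
  rewrite -big_split; apply: eq_bigr => i _; rewrite -big_split.
  by apply: eq_bigr => j _; rewrite mxE mulrDr.
rewrite TE -[(3 + 1)%N]/4%N in R_trace.
rewrite (trace_difference_static g_metric majumdar M DX).
rewrite (current_static_time openU g_metric N_C2 majumdar phi_C2 DX).
rewrite -/x -/(N x) dotN.
move: (\sum_i \sum_j invmx (G X) i j * M X i j)
  (\sum_i \sum_j invmx (G X) i j * E X i j)
  (scalar_curvature G X) (M X time_index time_index)
  (E X time_index time_index) (laplacian g phi x) (gradient_dot g phi phi x)
  (N x) N0 R_trace R_tt E_trace E_tt.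
move=> m e r mt et L dp Nx N0 R_trace R_tt E_trace E_tt.
(* In dimension four the trace equation reads [r - 2 * r = - kappa * (m + e)], and [kappa * e = 0].
   The next line is the time-time equation; adding the two cancels [r]. *)
have km : kappa * m = r by lra.
have kmt : kappa * mt = Nx * (s * L) - 2^-1 * r * Nx ^+ 2 - dp by lra.
transitivity (2^-1 * (kappa * m) + Nx ^- 2 * (kappa * mt)); first by field.
(* The current carries [s ^+ 2] in front of [dp] and the field equations carry 1, so this is where
   the Majumdar sign condition enters. *)
transitivity (s * L / Nx - s ^+ 2 * dp / Nx ^+ 2); last by field.
by rewrite km kmt s_sq; field.
Qed.

(** Where there is charge, the vanishing spatial current forces the spatial velocity to vanish. The
    normalization then gives $(N V^t)^2 = 1$, and $V^t > 0$ selects the root with the sign of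
    [N]. *)
Lemma static_charge_velocity (kappa : R) (sigma : 'rV[R]_(3 + 1) -> R) V X :
  kappa != 0 -> sigma X != 0 ->
  four_velocity G V D -> maxwell_equations kappa G A sigma V D -> D X ->
  N (spatial_part X) * V X ord0 time_index = Num.sg (N (spatial_part X)).
Proof.
move=> kappa0 sigma0 vel max DX; set x := spatial_part X.
have N_C2 : twice_derivable U N by exact: twice_derivable_affine.
have N0 : N x != 0 by exact: (lapse_neq0 majumdar DX).
have V0 k : V X ord0 (space_index k) = 0.
  have := max X DX (space_index k).
  rewrite (current_static_space openU g_metric N_C2 majumdar phi k DX).
  move/esym/eqP; rewrite !mulf_eq0 invr_eq0 pnatr_eq0 (negbTE kappa0).
  by rewrite (negbTE sigma0) => /eqP.
have [unitV Vt0] := vel X DX.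
rewrite (static_rest_velocity g majumdar DX V0) in unitV.
have : (N x * V X ord0 time_index) ^+ 2 == 1.
  by rewrite -eqr_opp unitV.
have := sgrM (N x) (V X ord0 time_index); rewrite (gtr0_sg Vt0) mulr1 => <-.
by rewrite sqrf_eq1 => /orP[] /eqP ->; rewrite ?sgrN1 ?sgr1.
Qed.

Lemma majumdar_charge (kappa : R) (M E : 'rV[R]_(3 + 1) -> 'M[R]_(3 + 1))
    (sigma : 'rV[R]_(3 + 1) -> R) V X :
  kappa != 0 ->
  (forall i j, 2^-1 * kappa * E X i j = em_stress G A X i j) ->
  four_velocity G V D -> einstein_equations kappa G (fun X => M X + E X) D ->
  maxwell_equations kappa G A sigma V D -> D X ->
  trace_difference G M X
  = s * Num.sg (N (spatial_part X)) * sigma X.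
Proof.
move=> kappa0 E_def vel ein max DX.
have k0 : 2^-1 * kappa != 0 by rewrite mulf_neq0 ?invr_eq0 ?pnatr_eq0.
apply: (mulfI k0); rewrite (majumdar_trace E_def ein DX) (max X DX).
(* Without charge at [X], the Maxwell equations say nothing about the velocity, but both sides
   vanish. *)
have [->|sigma0] := eqVneq (sigma X) 0; first by rewrite !(mulr0, mul0r).
by rewrite -(static_charge_velocity kappa0 sigma0 vel max DX); ring.
Qed.

End Majumdar.

(** Since $e^{\omega/2} = |N|$ with [N = B / 2 + s * phi], the sign in the charge relation is [s]
    where [N] is positive and [- s] where it is negative. *)
Theorem mainTheorem3 (R : realType)
    (U : set 'rV[R]_3) (g : 'rV[R]_3 -> 'M[R]_3) (omega phi : 'rV[R]_3 -> R)
    (kappa : R) (M E : 'rV[R]_(3 + 1) -> 'M[R]_(3 + 1))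
    (sigma : 'rV[R]_(3 + 1) -> R) (V : 'rV[R]_(3 + 1) -> 'rV[R]_(3 + 1))
    (B s : R)
    (G := static_metric g omega) (A := electric_potential phi)
    (D := static_region U)
    (openU : open U)
    (g_metric : riemannian_metric U g)
    (omega_C2 : Ck 2 U omega) (phi_C2 : Ck 2 U phi)
    (kappa_neq0 : kappa != 0)
    (E_def : forall X, D X -> forall i j,
       2^-1 * kappa * E X i j = em_stress G A X i j)
    (V_velocity : four_velocity G V D)
    (einstein : einstein_equations kappa G (fun X => M X + E X) D)
    (maxwell : maxwell_equations kappa G A sigma V D)
    (s_sign : s = 1 \/ s = -1)
    (majumdar : forall x, U x -> expR (omega x) = (B / 2 + s * phi x) ^+ 2) :
  (forall X, D X ->
     trace_difference G M X
     = s * Num.sg (B / 2 + s * phi (spatial_part X)) * sigma X) /\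
  (connected U ->
     exists s' : R, (s' = 1 \/ s' = -1) /\
       forall X, D X -> trace_difference G M X = s' * sigma X).
Proof.
have s_sq : s ^+ 2 = 1 by case: s_sign => ->; rewrite ?sqrrN expr1n.
have phi_d2 := Ck2_twice_derivable phi_C2.
have charge X : D X -> trace_difference G M X
    = s * Num.sg (B / 2 + s * phi (spatial_part X)) * sigma X.
  move=> DX; exact: (majumdar_charge openU g_metric phi_d2 s_sq majumdar
    kappa_neq0 (E_def X DX) V_velocity einstein maxwell DX).
(* An empty [U] provides no base point for the sign; there the claim is vacuous and 1 serves. *)
split=> // cU; have [[x0 Ux0]|U0] := pselect (exists x, U x); last first.
  by exists 1; split=> [|X DX]; [left|case: U0; exists (spatial_part X)].
have N_neq0 x : U x -> B / 2 + s * phi x != 0.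
  exact: (lapse_neq0 majumdar).
have N_cont x : U x -> {for x, continuous (fun y => B / 2 + s * phi y)}.
  move=> Ux; have /differentiable_continuous cphi : differentiable phi x.
    by case: phi_C2 => dphi _; exact: dphi.
  apply: (@continuousD _ _ _ (cst (B / 2)) (fun y => s * phi y)).
    exact: cst_continuous.
  by apply: (@continuousM _ _ (cst s) phi) => //; exact: cst_continuous.
(* The sign is read off at the base point [x0] and carried over [U] by connectedness. *)
exists (s * Num.sg (B / 2 + s * phi x0)); split=> [|X DX].
  have := N_neq0 x0 Ux0; rewrite neq_lt => /orP[/ltr0_sg|/gtr0_sg] ->;
    case: s_sign => ->; rewrite ?mulrN ?mulr1 ?opprK; by [left|right].
rewrite charge//; congr (_ * _ * _).
exact: (connected_sgr_eq cU N_cont N_neq0).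
Qed.
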